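(* Let $f\colon\mathbb{R}^n\to\mathbb{R}\cup\{+\infty\}$ be a lower semi-continuous semi-algebraic function and let $S\subset\mathbb{R}^n$ be a closed semi-algebraic set such that $\mathrm{dom} f\cap S$ is nonempty and unbounded. Assume that the qualification condition $(\mathrm{QC})$ holds. Then $f$ attains its infimum on $S$ (i.e. there is $x^*\in S$ with $f(x^* )=\inf_{x\in S}f(x)$) if and only if $$\Sigma(f,S)\neq\emptyset\quad\text{and}\quad\min_{x\in\Sigma(f,S)}f(x)\le\min_{k\in K}\lambda_k.$$
   Context: Conventions. $\inf\emptyset=+\infty$ (also for minima over empty sets). $\|\cdot\|$ is the Euclidean norm on $\mathbb{R}^n$; $\mathbb{B}_R$ and $\mathbb{S}_R$ are the closed ball and the sphere of radius $R>0$ centered at $0$. A subset of $\mathbb{R}^n$ is semi-algebraic if it is a finite union of sets, each defined by finitely many polynomial equalities and strict inequalities; a map is semi-algebraic if its graph is (for $f\colon\mathbb{R}^n\to\mathbb{R}\cup\{+\infty\}$ the graph is $\{(x,y)\in\mathbb{R}^n\times\mathbb{R}\mid y=f(x)\}$). $\mathrm{dom} f=\{x\mid f(x)<+\infty\}$, $\mathrm{epi} f=\{(x,\alpha)\in\mathbb{R}^n\times\mathbb{R}\mid f(x)\le\alpha\}$. Normals and subdifferentials. For $x\in S\subset\mathbb{R}^n$, the regular normal cone $\widehat N(x;S)$ is the set of $v$ with $\langle v,x'-x\rangle\le o(\|x'-x\|)$ as $x'\to x$, $x'\in S$. The limiting normal cone $N(x;S)$ is the set of $v$ for which there are $x_k\to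 x$, $x_k\in S$, and $v_k\to v$ with $v_k\in\widehat N(x_k;S)$. For $x\in\mathrm{dom} f$: $\partial f(x)=\{v\mid (v,-1)\in N((x,f(x));\mathrm{epi} f)\}$ and $\partial^\infty f(x)=\{v\mid (v,0)\in N((x,f(x));\mathrm{epi} f)\}$. $(\mathrm{QC})$: $\partial^\infty f(x)\cap(-N(x;S))=\{0\}$ for all $x\in\mathrm{dom} f\cap S$. Critical points: $\Sigma(f,S)=\{x\in\mathrm{dom} f\cap S\mid 0\in\partial f(x)+N(x;S)\}$; $f(\Sigma(f,S))$ is a finite subset of $\mathbb{R}$. Tangency variety: $\Gamma(f,S)=\{x\in\mathrm{dom} f\cap S\mid \exists\mu\in\mathbb{R}:\ 0\in\partial f(x)+N(x;S)+\mu x\}$ (a semi-algebraic set). Decomposition at infinity. Fix a finite partition of $\Gamma(f,S)$ into semi-algebraic sets $C_1,\ldots,C_\ell$ on each of which $f$ is continuous. By Hardt's triviality theorem applied to $x\mapsto\|x\|$ on $\Gamma(f,S)$, there are $R>0$, semi-algebraic sets $F_1,\ldots,F_\ell$ and a semi-algebraic homeomorphism $h\colon(\cup_i F_i)\times(R,+\infty)\to\Gamma(f,S)\setminus\mathbb{B}_R$ with $\|h(x,t)\|=t$ and $h(F_i\times(R,+\infty))=C_i\setminus\mathbb{B}_R$ for all $i$. Let $\Gamma_1,\ldots,\Gamma_p$ be the sets $h(F'\times(R,+\infty))$, with $F'$ running over the connected components of $F_1,\ldots,F_\ell$. Thus $\Gamma(f,S)\setminus\mathbb{B}_R$ is the disjoint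 union of the semi-algebraic sets $\Gamma_k$; each $\Gamma_k$ is connected and unbounded, $\Gamma_k\cap\mathbb{S}_t$ is nonempty and connected for each $t>R$, and $f|_{\Gamma_k}$ is continuous. $R$ may be increased to $R'$ by restricting $h$, i.e. replacing $\Gamma_k$ by $\Gamma_k\setminus\mathbb{B}_{R'}$. Under $(\mathrm{QC})$, for $R$ large enough $f$ is constant on each $\Gamma_k\cap\mathbb{S}_t$, $t>R$, so $f_k\colon(R,+\infty)\to\mathbb{R}$, $f_k(t):=f(x)$ for any $x\in\Gamma_k\cap\mathbb{S}_t$, is well defined; it is semi-algebraic and, for $R$ large enough, either constant or strictly monotone, hence $\lambda_k:=\lim_{t\to+\infty}f_k(t)\in\mathbb{R}\cup\{\pm\infty\}$ exists. $R$ is fixed sufficiently large (the claim is for all sufficiently large $R$). $K:=\{k\in\{1,\ldots,p\}\mid f_k\text{ is not constant}\}$. *)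

(* Defs.v *)
From HB Require Import structures.
From mathcomp Require Import all_boot all_order all_algebra.
From mathcomp Require Import all_classical all_reals all_analysis.
(* Not imported: the notations of mpoly clash with those of mathcomp-analysis. *)
From mathcomp Require mpoly.

Set Implicit Arguments.
Unset Strict Implicit.
Unset Printing Implicit Defensive.

Import Order.TTheory GRing.Theory Num.Theory.
Import numFieldNormedType.Exports.

Local Open Scope classical_set_scope.
Local Open Scope ring_scope.

Section Euclidean.
Context {R : realType}.

Definition dot n (u v : 'rV[R]_n) : R := \sum_(i < n) u 0 i * v 0 i.

(* The library norm `|x| on 'rV[R]_n is the sup norm: it has the same topology,
   but not the same spheres. *)
Definition enorm n (x : 'rV[R]_n) : R := Num.sqrt (dot x x).

Definition eball n (r : R) : set 'rV[R]_n := [set x | enorm x <= r].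

Definition esphere n (r : R) : set 'rV[R]_n := [set x | enorm x = r].

(* the point (x, a) of R^n x R, seen in R^(n+1) *)
Definition adjoin n (x : 'rV[R]_n) (a : R) : 'rV[R]_(n + 1) := row_mx x a%:M.

End Euclidean.

Section Semialgebraic.
Context {R : realType}.

(* A finite union (has) of sets, each given by a finite list b.1 of polynomial
   equalities p = 0 and a finite list b.2 of strict inequalities q > 0. *)
Definition semialgebraic n (A : set 'rV[R]_n) : Prop :=
  exists s : seq (seq (mpoly.mpoly n R) * seq (mpoly.mpoly n R)),
    A = [set x | has (fun b =>
                   all (fun p => mpoly.meval (x 0) p == 0) b.1 &&
                   all (fun q => 0 < mpoly.meval (x 0) q) b.2) s].

(* Only the finite values of f contribute to its graph. *)
Definition semialgebraic_efun n (f : 'rV[R]_n -> \bar R) : Prop :=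
  semialgebraic
    [set z | exists x y, z = adjoin x y /\ y%:E = f x].

(* semi-algebraicity of the restriction to D of h : R^m x R -> R^n *)
Definition semialgebraic_on m n (D : set ('rV[R]_m * R))
    (h : 'rV[R]_m * R -> 'rV[R]_n) : Prop :=
  semialgebraic
    [set z | exists2 u, D u & z = row_mx (adjoin u.1 u.2) (h u)].

End Semialgebraic.

Section Subdifferentials.
Context {R : realType}.

Definition regular_normal n (S : set 'rV[R]_n) (x : 'rV[R]_n) :
    set 'rV[R]_n :=
  [set v | forall e : R, 0 < e ->
    \forall y \near x, S y -> dot v (y - x) <= e * enorm (y - x)].

Definition limiting_normal n (S : set 'rV[R]_n) (x : 'rV[R]_n) :
    set 'rV[R]_n :=
  [set v | exists xs vs : nat -> 'rV[R]_n,
    [/\ forall k, S (xs k) /\ regular_normal S (xs k) (vs k),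
        xs @ \oo --> x & vs @ \oo --> v]].

Definition edom n (f : 'rV[R]_n -> \bar R) : set 'rV[R]_n :=
  [set x | (f x < +oo)%E].

Definition epigraph n (f : 'rV[R]_n -> \bar R) : set 'rV[R]_(n + 1) :=
  [set z | exists x a, z = adjoin x a /\ (f x <= a%:E)%E].

(* The next two sets are meaningful for x in edom f, where f is finite. *)
Definition subdiff n (f : 'rV[R]_n -> \bar R) (x : 'rV[R]_n) :
    set 'rV[R]_n :=
  [set v | limiting_normal (epigraph f) (adjoin x (fine (f x)))
             (adjoin v (-1))].

Definition horizon_subdiff n (f : 'rV[R]_n -> \bar R) (x : 'rV[R]_n) :
    set 'rV[R]_n :=
  [set v | limiting_normal (epigraph f) (adjoin x (fine (f x)))
             (adjoin v 0)].

Definition QC n (f : 'rV[R]_n -> \bar R) (S : set 'rV[R]_n) : Prop :=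
  forall x, (edom f `&` S) x ->
    horizon_subdiff f x `&` [set - v | v in limiting_normal S x] = [set 0].

Definition critical_points n (f : 'rV[R]_n -> \bar R) (S : set 'rV[R]_n) :
    set 'rV[R]_n :=
  [set x | (edom f `&` S) x /\
    [set u + v | u in subdiff f x & v in limiting_normal S x] 0].

Definition tangency_variety n (f : 'rV[R]_n -> \bar R) (S : set 'rV[R]_n) :
    set 'rV[R]_n :=
  [set x | (edom f `&` S) x /\ exists mu : R,
    [set u + v + mu *: x | u in subdiff f x & v in limiting_normal S x] 0].

End Subdifferentials.

Section Decomposition.
Context {R : realType}.

Definition homeomorphism_on (T U : topologicalType) (A : set T) (B : set U)
    (h : T -> U) : Prop :=
  set_bij A B h /\ {within A, continuous h} /\
  exists g : U -> T, {in A, cancel h g} /\ {within B, continuous g}.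

Definition connected_components (T : topologicalType) (A : set T) :
    set (set T) :=
  [set connected_component A x | x in A].

Definition ray (rho : R) : set R := [set t | rho < t].

(* A decomposition of the tangency variety outside the ball of radius rho:
   a partition C of the variety, a trivialization h of the Euclidean norm with
   fibres F (subsets of R^m), and the list G of the images under h of the
   cylinders over the connected components of the fibres.  Enlarging rho means
   restricting h, which yields another instance of this predicate. *)
Record decomposition_at_infinity n (f : 'rV[R]_n -> \bar R)
    (S : set 'rV[R]_n) (rho : R)
    (l : nat) (C : 'I_l -> set 'rV[R]_n)
    (m : nat) (F : 'I_l -> set 'rV[R]_m) (h : 'rV[R]_m * R -> 'rV[R]_n)
    (p : nat) (G : 'I_p -> set 'rV[R]_n) : Prop := DecompositionAtInfinity {
  dec_radius : 0 < rho ;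
  dec_cover : \bigcup_i C i = tangency_variety f S ;
  dec_disjoint : trivIset setT C ;
  dec_C_semialg : forall i, semialgebraic (C i) ;
  dec_C_cont : forall i, {within C i, continuous f} ;
  dec_F_semialg : forall i, semialgebraic (F i) ;
  dec_h_semialg : semialgebraic_on ((\bigcup_i F i) `*` ray rho) h ;
  dec_h_homeo : homeomorphism_on ((\bigcup_i F i) `*` ray rho)
    (tangency_variety f S `\` @eball R n rho) h ;
  dec_h_norm : forall x t, (\bigcup_i F i) x -> rho < t -> enorm (h (x, t)) = t ;
  dec_h_C : forall i, h @` (F i `*` ray rho) = C i `\` @eball R n rho ;
  dec_G : set_bij setT
    [set h @` (F' `*` ray rho)
       | F' in \bigcup_i connected_components (F i)] G }.

(* fk k t is the value of f at any point of G k on the sphere of radius t. *)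
Definition slice_values n (f : 'rV[R]_n -> \bar R) (rho : R)
    (p : nat) (G : 'I_p -> set 'rV[R]_n) (fk : 'I_p -> R -> R) : Prop :=
  forall k t x, rho < t -> (G k `&` @esphere R n t) x -> f x = (fk k t)%:E.

Definition nonconstant_indices (rho : R) (p : nat) (fk : 'I_p -> R -> R) :
    set 'I_p :=
  [set k | ~ exists c, forall t, rho < t -> fk k t = c].

End Decomposition.

(* least element, with the convention that the minimum of set0 is +oo *)
Definition is_minimum {R : realType} (A : set (\bar R)) (m : \bar R) : Prop :=
  (A m /\ lbound A m) \/ (A = set0 /\ m = +oo%E).

(* Main.v *)
Require Import Defs.
From HB Require Import structures.
From mathcomp Require Import all_boot all_order all_algebra.
From mathcomp Require Import all_classical all_reals all_analysis.
From mathcomp Require Import ring lra.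

(** Two facts carry the proof.

    The first is a multiplier rule, [QC_sum_rule]: if [x] is a local minimizer
    on [S] of [f] plus a function with linear part [w] at [x] and quadratic
    error, then the qualification condition gives [u] in the subdifferential of
    [f] and [v] normal to [S] with [u + v + w = 0].  It is obtained by splitting
    the variable, [f] acting on one copy and the constraint on the other, with
    a quadratic penalty on their difference ([decoupled_minimizers],
    [fuzzy_sum_rule]), and then by passing to the limit in suitably scaled
    multipliers.  With [w = 0] it says that minimizers of [f] on [S] are
    critical.

    The second, [tangency_minimizer], produces for every ball centred at [0]
    that contains a point of [S] where [f] is finite a point [x] of the tangency
    variety with [f x <= f y] for all [y] of [S] in this ball: minimize [f] plus
    a smooth radial penalty that vanishes on the ball, and apply the multiplier
    rule, whose [w] is then a multiple of [x].

    If [f] attains its infimum at [x], then [x] is critical and [f x] is the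
    least critical value; each [lam k] is a limit of values of [f] on [S],
    hence at least [f x].  Conversely, take the points [x j] of the second fact
    for radii tending to infinity.  If infinitely many lie in a fixed ball, the
    infimum is attained by compactness.  Otherwise infinitely many of them lie
    in one piece [G k], and each value of [f] on [S] is eventually at least
    [f (x j)].  If [fk k] is constant, this constant is the infimum
    and it is attained in [G k].  If not, [lam k] is at most the infimum of [f],
    and so is the least critical value, which is a value of [f] on [S]. *)

Import Order.TTheory GRing.Theory Num.Theory.
Import numFieldNormedType.Exports.

Local Open Scope classical_set_scope.
Local Open Scope ring_scope.

Set Implicit Arguments.
Unset Strict Implicit.
Unset Printing Implicit Defensive.

(** * Semicontinuity, compactness and the Euclidean structure *)

Section Toolbox.
Context {R : realType}.

Lemma fineK_lty (a : \bar R) : a <> -oo%E -> (a < +oo)%E -> (fine a)%:E = a.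
Proof. by case: a. Qed.

(** The sublevel sets of [g] in [A] form a chain, hence a filter base; by lower
    semicontinuity a cluster point of that filter belongs to all of them. *)
Lemma lsc_attains_min (T : topologicalType) (A : set T) (g : T -> \bar R) :
  (forall x, g x <> -oo%E) -> lower_semicontinuous g -> compact A -> A !=set0 ->
  exists2 c, A c & forall y, A y -> (g c <= g y)%E.
Proof.
move=> gNy lscg cA [a Aa].
pose B y := [set x | A x /\ (g x <= g y)%E].
have FF : Filter (filter_from A B).
  apply: filter_from_filter; first by exists a.
  move=> x y Ax Ay; have [xy|yx] := leP (g x) (g y).
    by exists x => // z [Az zx]; do !split=> //; exact: le_trans zx xy.
  by exists y => // z [Az zy]; do !split=> //; exact: le_trans zy (ltW yx).
have PF : ProperFilter (filter_from A B).
  by apply: filter_from_proper => // y Ay; exists y; split.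
have FA : filter_from A B A by exists a => // z [].
have [c [Ac clc]] := cA _ PF FA.
exists c => // y Ay; rewrite leNgt; apply/negP => yc.
have gyE : (fine (g y))%:E = g y.
  by apply: fineK_lty => //; rewrite (lt_le_trans yc)// leey.
move: yc; rewrite -gyE => /lscg[V cV Vlt].
have [z [[Az zy] Vz]] := clc (B y) V (ex_intro2 _ _ y Ay (@subset_refl _ _)) cV.
by have := Vlt _ Vz; rewrite gyE ltNge zy.
Qed.

Lemma lsc_addr (T : topologicalType) (g : T -> \bar R) (phi : T -> R) :
  lower_semicontinuous g -> continuous phi ->
  lower_semicontinuous (fun x => g x + (phi x)%:E)%E.
Proof.
move=> lscg cphi x a ax.
have [e e0 le] : exists2 e : R, 0 < e & ((a - phi x + e)%:E < g x)%E.
  case: (g x) ax => [r| |]; [|by move=> _; exists 1; rewrite ?ltry|by []].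
  rewrite -EFinD lte_fin => ar; exists ((r - (a - phi x)) / 2).
    by lra.
  by rewrite lte_fin; lra.
have [V xV Vlt] := lscg _ _ le.
have phiV : \forall y \near x, `|phi x - phi y| < e.
  by move/cvgrPdist_lt : (cphi x) => /(_ _ e0).
exists (V `&` [set y | `|phi x - phi y| < e]); first exact: filterI.
move=> y [/Vlt + /=]; case: (g y) => [r| |]; [|by move=> _ _; rewrite addye ?ltry|by []].
by rewrite -EFinD !lte_fin ltr_norml => ? /andP[? ?]; lra.
Qed.

Lemma lsc_comp (T U : topologicalType) (g : U -> \bar R) (h : T -> U) :
  lower_semicontinuous g -> continuous h ->
  lower_semicontinuous (fun x => g (h x)).
Proof.
by move=> lscg ch x a /lscg[V hV Vlt]; exists (h @^-1` V); [exact: ch|move=> y /Vlt].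
Qed.

(** Used in place of extracting subsequences, to avoid reindexing. *)
Lemma compact_seq_cluster (T : topologicalType) (A : set T) (q : nat -> T) :
  compact A -> (forall k, A (q k)) ->
  exists2 c, A c & forall V N, nbhs c V -> exists2 k, (N <= k)%N & V (q k).
Proof.
move=> cA Aq.
have [c [Ac clc]] := cA (q @ \oo) _ (filterE _ Aq).
exists c => // V N cV.
have [|x [[k Nk <-] Vx]] := clc (q @` [set k | (N <= k)%N]) V _ cV; last by exists k.
by exists N => // k /= Nk; exists k.
Qed.

Lemma dotC n (u v : 'rV[R]_n) : dot u v = dot v u.
Proof. by apply: eq_bigr => i _; rewrite mulrC. Qed.

Lemma dotDl n (u v w : 'rV[R]_n) : dot (u + v) w = dot u w + dot v w.
Proof. by rewrite -big_split; apply: eq_bigr => i _; rewrite mxE mulrDl. Qed.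

Lemma dotZl n a (u v : 'rV[R]_n) : dot (a *: u) v = a * dot u v.
Proof. by rewrite [RHS]mulr_sumr; apply: eq_bigr => i _; rewrite mxE mulrA. Qed.

Lemma dotNl n (u v : 'rV[R]_n) : dot (- u) v = - dot u v.
Proof. by rewrite -scaleN1r dotZl mulN1r. Qed.

Lemma dotDr n (u v w : 'rV[R]_n) : dot w (u + v) = dot w u + dot w v.
Proof. by rewrite dotC dotDl !(dotC w). Qed.

Lemma dotZr n a (u v : 'rV[R]_n) : dot v (a *: u) = a * dot v u.
Proof. by rewrite dotC dotZl (dotC v). Qed.

Lemma dotNr n (u v : 'rV[R]_n) : dot v (- u) = - dot v u.
Proof. by rewrite dotC dotNl (dotC v). Qed.

Definition dotE := (dotDl, dotDr, dotNl, dotNr, dotZl, dotZr).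

Lemma dot0 n (u : 'rV[R]_n) : dot u 0 = 0.
Proof. by rewrite -(scale0r 0) dotZr mul0r. Qed.

Lemma dot_ge0 n (u : 'rV[R]_n) : 0 <= dot u u.
Proof. by apply: sumr_ge0 => i _; rewrite -expr2 sqr_ge0. Qed.

Lemma dot_eq0 n (u : 'rV[R]_n) : dot u u <= 0 -> u = 0.
Proof.
move=> u0; have /eqP : dot u u = 0 by apply/eqP; rewrite eq_le u0 dot_ge0.
rewrite psumr_eq0 => [/allP u0'|i _]; last by rewrite -expr2 sqr_ge0.
apply/rowP => i; rewrite mxE; apply/eqP.
by have := u0' i (mem_index_enum i); rewrite /= mulf_eq0 orbb.
Qed.

Lemma enorm_ge0 n (u : 'rV[R]_n) : 0 <= enorm u.
Proof. exact: sqrtr_ge0. Qed.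

Lemma enorm_sqr n (u : 'rV[R]_n) : enorm u ^+ 2 = dot u u.
Proof. by rewrite sqr_sqrtr// dot_ge0. Qed.

Lemma enorm_le n (u : 'rV[R]_n) r : 0 <= r -> (enorm u <= r) = (dot u u <= r ^+ 2).
Proof. by move=> r0; rewrite -enorm_sqr ler_sqr// ?nnegrE// enorm_ge0. Qed.

Lemma dot_adjoin n (u v : 'rV[R]_n) a b :
  dot (adjoin u a) (adjoin v b) = dot u v + a * b.
Proof.
rewrite /dot big_split_ord/=; congr (_ + _).
  by apply: eq_bigr => i _; rewrite !row_mxEl.
by rewrite big_ord1 !row_mxEr !mxE.
Qed.

Lemma adjoinB n (u v : 'rV[R]_n) a b :
  adjoin u a - adjoin v b = adjoin (u - v) (a - b).
Proof. by rewrite /adjoin opp_row_mx add_row_mx -rmorphN -rmorphD. Qed.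

Lemma adjoinZ n c (u : 'rV[R]_n) a : c *: adjoin u a = adjoin (c *: u) (c * a).
Proof. by rewrite /adjoin scale_row_mx scale_scalar_mx. Qed.

Lemma rV_norm_lt n (x : 'rV[R]_n) e : 0 < e ->
  (`|x| < e) <-> (forall i, `|x 0 i| < e).
Proof.
move=> e0; rewrite [X in X < _]/Num.norm/= mx_normrE; split => [/bigmax_ltP[_ xe] i|xe].
  exact: (xe (0, i)).
by apply/bigmax_ltP; split => // -[i j] _ /=; rewrite ord1.
Qed.

Lemma adjoin_norm_lt n (x : 'rV[R]_n) a e : 0 < e ->
  (`|adjoin x a| < e) <-> `|x| < e /\ `|a| < e.
Proof.
move=> e0; rewrite !rV_norm_lt//; split=> [xe|[xe ae] i].
  split=> [i|]; first by have := xe (lshift 1 i); rewrite row_mxEl.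
  by have := xe (rshift n 0); rewrite row_mxEr mxE eqxx.
case: (split_ordP i) => j ->; first by rewrite row_mxEl.
by rewrite row_mxEr ord1 mxE eqxx.
Qed.

Lemma dot_continuous (T : topologicalType) n (g h : T -> 'rV[R]_n) :
  continuous g -> continuous h -> continuous (fun x => dot (g x) (h x)).
Proof.
move=> cg ch; apply: continuous_big; first exact: add_continuous.
move=> i _ x; apply: cvgM.
  apply: (@continuous_comp _ _ _ g (fun M : 'rV[R]_n => M 0 i)); first exact: cg.
  exact: coord_continuous.
apply: (@continuous_comp _ _ _ h (fun M : 'rV[R]_n => M 0 i)); first exact: ch.
exact: coord_continuous.
Qed.

End Toolbox.

(** * Constructing regular and limiting normals *)

Section Normals.
Context {R : realType}.

Lemma near_norm_lt n (x : 'rV[R]_n) (P : set 'rV[R]_n) :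
  (\forall y \near x, P y) ->
  exists2 d : R, 0 < d & forall y, `|y - x| < d -> P y.
Proof.
move=> /nbhs_ballP[d /= d0 dP]; exists d => // y yx; apply: dP.
by rewrite -ball_normE /ball_ /= distrC.
Qed.

Lemma norm_lt_near n (x : 'rV[R]_n) (d : R) :
  0 < d -> \forall y \near x, `|y - x| < d.
Proof.
move=> d0; apply/nbhs_ballP; exists d => //= y.
by rewrite -ball_normE /ball_ /= distrC.
Qed.

Lemma shift_continuous n (x : 'rV[R]_n) : continuous (fun y : 'rV[R]_n => y - x).
Proof. by move=> y; apply: (@cvgB _ _ _ (nbhs y) _ id (cst x)); [exact: cvg_id|exact: cvg_cst]. Qed.

Lemma cball_compact n (x : 'rV[R]_n) r : compact [set y : 'rV[R]_n | `|y - x| <= r].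
Proof.
apply: bounded_closed_compact.
  exists (`|x| + r); split=> [|M rM y /= yr]; first exact: num_real.
  rewrite -(subrK x y) (le_trans (ler_normD _ _))//.
  by rewrite (le_trans _ (ltW rM))// addrC lerD2l.
rewrite (_ : mkset _ = (fun y : 'rV[R]_n => `|y - x|) @^-1` [set t | t <= r])//.
have c : continuous (fun y : 'rV[R]_n => `|y - x|).
  by move=> y; apply: (@cvg_norm _ _ _ (nbhs y) _ (fun z => z - x)); exact: shift_continuous.
by apply: closed_comp => [y _|]; [exact: c|exact: closed_le].
Qed.

(** A quadratic error is [o(|y - x|)].  Every regular normal constructed below
    comes from such a proximal inequality. *)
Lemma proximal_regular_normal n (S : set 'rV[R]_n) (x v : 'rV[R]_n) c :
  (\forall y \near x, S y -> dot v (y - x) <= c * dot (y - x) (y - x)) ->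
  regular_normal S x v.
Proof.
move=> vc e e0.
have d0 : 0 < e / (`|c| + 1) by rewrite divr_gt0// ltr_pwDr.
have near0 : \forall y \near x, dot (y - x) (y - x) < (e / (`|c| + 1)) ^+ 2.
  have /(_ x) := dot_continuous (@shift_continuous n x) (@shift_continuous n x).
  move=> /cvgrPdist_lt /(_ ((e / (`|c| + 1)) ^+ 2)) /=.
  rewrite exprn_gt0// => /(_ isT); apply: filterS => y.
  by rewrite distrC subrr dot0 subr0 ltr_norml => /andP[].
move: vc near0; apply: filterS2 => y vcy ylt Sy.
have yx : enorm (y - x) <= e / (`|c| + 1) by rewrite enorm_le ltW.
apply: (le_trans (vcy Sy)).
rewrite -enorm_sqr expr2 mulrA ler_wpM2r ?enorm_ge0//.
apply: (@le_trans _ _ ((`|c| + 1) * enorm (y - x))).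
  by rewrite ler_wpM2r ?enorm_ge0// (le_trans (ler_norm c))// lerDl.
by rewrite mulrC -ler_pdivlMr// ltr_pwDr.
Qed.

(** A quadratic minorant of [f] touching it at height [a] over [y] turns into a
    proximal inequality for the epigraph: the slack [b - a] of a point
    [(y', b)] enters with coefficient [-1]. *)
Lemma proximal_epigraph_normal n (f : 'rV[R]_n -> \bar R) (y u : 'rV[R]_n) a c :
  0 <= c ->
  (\forall y' \near y,
     ((a + dot u (y' - y) - c * dot (y' - y) (y' - y))%:E <= f y')%E) ->
  regular_normal (epigraph f) (adjoin y a) (adjoin u (-1)).
Proof.
move=> c0 /near_norm_lt[d d0 dP].
apply: (@proximal_regular_normal _ _ _ _ c).
apply: filterS (norm_lt_near (adjoin y a) d0) => zeta + [y' [b [zE fb]]].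
rewrite {}zE adjoinB => /(adjoin_norm_lt _ _ d0)[y'y _].
have := le_trans (dP _ y'y) fb; rewrite lee_fin !dot_adjoin => le.
have : 0 <= c * (b - a) ^+ 2 by rewrite mulr_ge0 ?sqr_ge0.
by lra.
Qed.

Lemma regular_normalZ n (S : set 'rV[R]_n) (x v : 'rV[R]_n) c : 0 < c ->
  regular_normal S x v -> regular_normal S x (c *: v).
Proof.
move=> c0 xv e e0; have := xv (e / c) (divr_gt0 e0 c0).
apply: filterS => y /[apply]; rewrite dotZl => ve.
by rewrite -ler_pdivlMl// mulrA (mulrC c^-1).
Qed.

(** The diagonal form of the definition: no sequences need be built. *)
Lemma limiting_normal_approx n (S : set 'rV[R]_n) (x v : 'rV[R]_n) :
  (forall e : R, 0 < e -> exists x' v', [/\ S x', regular_normal S x' v',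
     `|x' - x| < e & `|v' - v| < e]) ->
  limiting_normal S x v.
Proof.
move=> xv.
have /choice[q qP] : forall k : nat, exists q : 'rV[R]_n * 'rV[R]_n,
    [/\ S q.1, regular_normal S q.1 q.2,
     `|q.1 - x| < k.+1%:R^-1 & `|q.2 - v| < k.+1%:R^-1].
  move=> k; have [|x' [v' xv']] := xv k.+1%:R^-1; first by rewrite invr_gt0.
  by exists (x', v').
exists (fst \o q), (snd \o q); split=> [k||]; first by case: (qP k).
  apply/cvgrPdist_lt => e e0; have := near_infty_natSinv_lt (PosNum e0).
  apply: filterS => k /= ke; rewrite distrC; apply: lt_trans ke.
  by case: (qP k).
apply/cvgrPdist_lt => e e0; have := near_infty_natSinv_lt (PosNum e0).
apply: filterS => k /= ke; rewrite distrC; apply: lt_trans ke.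
by case: (qP k).
Qed.

Lemma limiting_normalZ n (S : set 'rV[R]_n) (x v : 'rV[R]_n) c : 0 < c ->
  limiting_normal S x v -> limiting_normal S x (c *: v).
Proof.
move=> c0 [xs [vs [sv xsx vsv]]].
exists xs, (fun k => c *: vs k); split=> // [k|].
  by have [? ?] := sv k; split=> //; exact: regular_normalZ.
by apply: cvgZr.
Qed.

End Normals.

(** * The sum rule for local minimizers *)

Section SumRule.
Context {R : realType}.

(** Quadratic penalization: [f y + g z] is minimized with [y] free of the
    constraint and only [z] kept in [S], the two copies being tied by
    [k |y - z|^2].  As [k] grows the bound [f x] on the minimal value forces
    [y - z] to [0], so that cluster points of the minimizers are minimizers of
    [f + g] on [S] near [x], and [x] is the only one. *)
Lemma decoupled_minimizers n (f : 'rV[R]_n -> \bar R) (S : set 'rV[R]_n)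
    (x : 'rV[R]_n) (g : 'rV[R]_n -> R) (r : R) :
  (forall y, f y <> -oo%E) -> lower_semicontinuous f -> closed S ->
  continuous g -> g x = 0 -> (edom f `&` S) x -> 0 < r ->
  (forall y, S y -> `|y - x| <= r -> (f y + (g y)%:E <= f x)%E -> y = x) ->
  forall e : R, 0 < e -> exists (k : nat) (y z : 'rV[R]_n),
    [/\ edom f y, S z, `|y - x| < e, `|z - x| < e
      & `|fine (f y) - fine (f x)| < e] /\
    forall y' z', `|y' - x| <= r -> `|z' - x| <= r -> S z' ->
      (f y + (g z + k%:R * dot (y - z) (y - z))%:E
        <= f y' + (g z' + k%:R * dot (y' - z') (y' - z'))%:E)%E.
Proof.
move=> fNy lscf clS cont_g g0 [fx Sx] r0 strict e e0.
have ffin y : (f y < +oo)%E -> (fine (f y))%:E = f y by exact: fineK_lty.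
pose A := [set y : 'rV[R]_n | `|y - x| <= r].
have Ax : A x by rewrite /A /= subrr normr0 ltW.
have cA : compact A by exact: cball_compact.
pose K : set ('rV[R]_n * 'rV[R]_n) := A `*` (A `&` S).
have cK : compact K by apply: compact_setX => //; exact: compact_closedI.
have cfst : continuous (fst : 'rV[R]_n * 'rV[R]_n -> 'rV[R]_n).
  by move=> ?; exact: cvg_fst.
have csnd : continuous (snd : 'rV[R]_n * 'rV[R]_n -> 'rV[R]_n).
  by move=> ?; exact: cvg_snd.
pose gap (p : 'rV[R]_n * 'rV[R]_n) := dot (p.1 - p.2) (p.1 - p.2).
have cont_gap : continuous gap.
  have c1 : continuous (fun p : 'rV[R]_n * 'rV[R]_n => p.1 - p.2).
    by move=> p; apply: (@cvgB _ _ _ (nbhs p) _ fst snd); [exact: cfst|exact: csnd].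
  exact: dot_continuous.
have gap_ge0 p : 0 <= gap p by exact: dot_ge0.
have cont_g2 : continuous (fun p : 'rV[R]_n * 'rV[R]_n => g p.2).
  by move=> p; apply: (@continuous_comp _ _ _ snd g); [exact: csnd|exact: cont_g].
have lsc1 : lower_semicontinuous (fun p : 'rV[R]_n * 'rV[R]_n => f p.1).
  exact: lsc_comp.
pose theta (k : nat) p := (f p.1 + (g p.2 + k%:R * gap p)%:E)%E.
have /choice[p pP] : forall k, exists p, K p /\ forall q, K q -> (theta k p <= theta k q)%E.
  move=> k; have [||||p Kp pP] := @lsc_attains_min _ _ K (theta k).
  - by move=> p; rewrite /theta; case: (f p.1) (fNy p.1).
  - apply: lsc_addr => // q; apply: (cvgD (cont_g2 q)).
    by apply: cvgMl_tmp; exact: cont_gap.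
  - exact: cK.
  - by exists (x, x).
  - by exists p.
have Kp k : K (p k) by have [] := pP k.
pose a k := fine (f (p k).1).
have Kxx : K (x, x) by [].
have thx k : theta k (x, x) = f x.
  by rewrite /theta /gap /= g0 subrr dot0 mulr0 addr0 adde0.
have fa k : f (p k).1 = (a k)%:E.
  rewrite ffin// ltey; apply/eqP => fpk; have [_ /(_ _ Kxx)] := pP k.
  by rewrite thx /theta fpk addye// leNgt fx.
have le_a k : a k + g (p k).2 + k%:R * gap (p k) <= fine (f x).
  have [_ /(_ _ Kxx)] := pP k.
  by rewrite thx /theta fa -(ffin x fx) -EFinD lee_fin addrA.
(* for k = 0 the penalty vanishes: p 0 minimizes f y + g z over K *)
have ge_a k : a 0%N + g (p 0%N).2 <= a k + g (p k).2.
  have [_ /(_ _ (Kp k))] := pP 0%N.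
  by rewrite /theta !fa -!EFinD lee_fin !mul0r !addr0.
have [[yb zb] [Ay [Az Sz]] clc] := compact_seq_cluster cK Kp.
rewrite /= in Ay Az Sz.
(* a positive gap at the cluster point would make k * gap (p k) unbounded *)
have yz : yb = zb.
  apply/eqP; rewrite -subr_eq0; apply/eqP; apply: dot_eq0; rewrite leNgt.
  apply/negP => D0; pose D := gap (yb, zb).
  pose bd := (fine (f x) - (a 0%N + g (p 0%N).2)) / (D / 2).
  have NP : bd < (Num.bound `|bd|)%:R.
    by rewrite (le_lt_trans (ler_norm _))// archi_boundP.
  have [|k Nk /= kD] := clc [set q | D / 2 < gap q] (Num.bound `|bd|).
    have /cvgrPdist_lt /(_ (D / 2)) := cont_gap (yb, zb).
    rewrite divr_gt0// => /(_ isT); apply: filterS => q /=.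
    by rewrite ltr_norml -/D => /andP[? ?]; lra.
  have := le_a k; have := ge_a k; move: NP; rewrite ltr_pdivrMr ?divr_gt0// => NP g1 g2.
  have : (Num.bound `|bd|)%:R * (D / 2) <= k%:R * gap (p k).
    by apply: ler_pM; rewrite ?ler0n ?ler_nat ?(ltW kD)// ltW// divr_gt0.
  by lra.
have fgz : (f zb + (g zb)%:E <= f x)%E.
  rewrite leNgt; apply/negP; rewrite -(ffin x fx) => lt.
  have [V cV Vlt] := lsc_addr lsc1 cont_g2 (x := (zb, zb)) lt.
  rewrite yz in clc; have [k _ Vk] := clc V 0%N cV.
  have := Vlt _ Vk; rewrite fa -EFinD lte_fin.
  have := le_a k; have := mulr_ge0 (ler0n R k) (gap_ge0 (p k)); lra.
have zx := strict zb Sz Az fgz; subst yb zb.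
have [V xV Vlt] : exists2 V, nbhs x V & forall y, V y -> ((fine (f x) - e)%:E < f y)%E.
  by apply: lscf; rewrite -(ffin x fx) lte_fin; lra.
have gV : \forall z \near x, `|g z| < e.
  have /cvgrPdist_lt /(_ e e0) := cont_g x; apply: filterS => z.
  by rewrite g0 sub0r normrN.
pose W := [set y | V y /\ `|y - x| < e] `*` [set z | `|g z| < e /\ `|z - x| < e].
have [|k _ [[Vy ye] [gz ze]]] := clc W 0%N.
  exists ([set y | V y /\ `|y - x| < e], [set z | `|g z| < e /\ `|z - x| < e]) => //=.
  by split; apply: filterI => //; exact: norm_lt_near.
exists k, (p k).1, (p k).2; split; last first.
  by move=> y' z' y'r z'r Sz'; exact: ((pP k).2 (y', z')).
split=> //; [by rewrite /edom /= fa ltry|by have [_ []] := Kp k|].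
have := Vlt _ Vy; rewrite fa lte_fin /= => ?.
have := mulr_ge0 (ler0n R k) (gap_ge0 (p k)); have := le_a k.
by move: gz; rewrite !ltr_norml => /andP[? ?] ? ?; apply/andP; split; lra.
Qed.

(** At a decoupled minimizer [(y, z)] each of [f] and [S] faces a smooth
    function only, so the optimality conditions in [y] and in [z] are proximal
    inequalities.  The gradients of the penalty in [y] and in [z] are opposite:
    they cancel in [u + v]. *)
Lemma fuzzy_sum_rule n (f : 'rV[R]_n -> \bar R) (S : set 'rV[R]_n)
    (x w : 'rV[R]_n) (C : R) :
  (forall y, f y <> -oo%E) -> lower_semicontinuous f -> closed S ->
  (edom f `&` S) x ->
  (\forall y \near x, S y ->
     (f x <= f y + (dot w (y - x) + C * dot (y - x) (y - x))%:E)%E) ->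
  forall e : R, 0 < e -> exists y z u v : 'rV[R]_n,
    [/\ edom f y, S z, `|y - x| < e, `|z - x| < e
      & `|fine (f y) - fine (f x)| < e] /\
    [/\ regular_normal (epigraph f) (adjoin y (fine (f y))) (adjoin u (-1)),
        regular_normal S z v & `|u + v + w| < e].
Proof.
move=> fNy lscf clS [fx Sx] /near_norm_lt[d d0 dP] e e0.
pose r := d / 2; have r0 : 0 < r by rewrite /r; lra.
(* C + 1 instead of C makes x a strict minimizer of f + g *)
pose g (z : 'rV[R]_n) := dot w (z - x) + (C + 1) * dot (z - x) (z - x).
have cont_g : continuous g.
  have c1 : continuous (fun z : 'rV[R]_n => dot w (z - x)).
    by apply: (@dot_continuous _ _ _ (cst w)); [exact: cst_continuous|exact: shift_continuous].
  have c2 : continuous (fun z : 'rV[R]_n => dot (z - x) (z - x)).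
    by apply: dot_continuous; exact: shift_continuous.
  by move=> z; apply: (cvgD (c1 z)); apply: cvgMl_tmp; exact: c2.
have g0 : g x = 0 by rewrite /g subrr !dot0 mulr0 addr0.
have strict y : S y -> `|y - x| <= r -> (f y + (g y)%:E <= f x)%E -> y = x.
  move=> Sy yr fg; have := dP y; rewrite (le_lt_trans yr) /r; last lra.
  move=> /(_ isT Sy) le1.
  have fy : (f y < +oo)%E.
    by rewrite ltey; apply/eqP => fy; move: fg; rewrite fy addye// leNgt fx.
  move: le1 fg; rewrite -(fineK_lty (fNy x) fx) -(fineK_lty (fNy y) fy).
  rewrite -!EFinD !lee_fin /g => le1 le2.
  by apply/eqP; rewrite -subr_eq0; apply/eqP; apply: dot_eq0; lra.
have den0 : 0 < 2 * `|C + 1| + 1 by rewrite ltr_pwDr// mulr_ge0.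
pose e' := Num.min e (Num.min r (e / (2 * `|C + 1| + 1))).
have e'0 : 0 < e' by rewrite /e' !lt_min e0 r0 divr_gt0.
have [k [y [z [[fy Sz]]]]] :=
  decoupled_minimizers fNy lscf clS cont_g g0 (conj fx Sx) r0 strict e'0.
rewrite !lt_min => /and3P[ye yr _] /and3P[ze zr ze'] /and3P[fye _ _] mp.
have yE := fineK_lty (fNy y) fy; pose a := fine (f y).
exists y, z, ((2 * k%:R) *: (z - y)),
  (- (w + (2 * (C + 1)) *: (z - x) + (2 * k%:R) *: (z - y))); split; split=> //.
- apply: (@proximal_epigraph_normal _ _ _ _ _ _ k%:R) => //.
  have d'0 : 0 < r - `|y - x| by lra.
  apply: filterS (norm_lt_near y d'0) => y' y'y.
  have y'r : `|y' - x| <= r.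
    rewrite -(subrK y y') -addrA (le_trans (ler_normD _ _))//.
    by move: y'y; lra.
  have := mp y' z y'r (ltW zr) Sz; rewrite -yE -/a.
  case: (f y') (fNy y') => [b _|_ _|//]; last exact: leey.
  rewrite -!EFinD !lee_fin.
  have -> : y' - z = (y' - y) + (y - z) by rewrite addrA subrK.
  rewrite -(opprB y z) /=; move: (y' - y) (y - z) => j q.
  by rewrite !dotE (dotC j q); lra.
- apply: (@proximal_regular_normal _ _ _ _ _ (C + 1 + k%:R)).
  have d'0 : 0 < r - `|z - x| by lra.
  apply: filterS (norm_lt_near z d'0) => z' z'z Sz'.
  have z'r : `|z' - x| <= r.
    rewrite -(subrK z z') -addrA (le_trans (ler_normD _ _))//.
    by move: z'z; lra.
  have := mp y z' (ltW yr) z'r Sz'; rewrite -yE -/a -!EFinD !lee_fin /g.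
  have -> : z' - x = (z' - z) + (z - x) by rewrite addrA subrK.
  have -> : y - z' = (y - z) - (z' - z) by rewrite opprB addrA subrK.
  rewrite -(opprB y z); move: (z' - z) (z - x) (y - z) => j i q.
  by rewrite !dotE (dotC j i) (dotC j q); lra.
- rewrite [X in `|X|](_ : _ = - ((2 * (C + 1)) *: (z - x))).
    rewrite normrN normrZ normrM (ger0_norm (ler0n R 2)).
    move: ze'; rewrite ltr_pdivlMr// => ze'.
    by have := normr_ge0 (z - x); lra.
  by apply/rowP => i; rewrite !mxE; ring.
Qed.

End SumRule.

Section ExactRule.
Context {R : realType}.

(** The multipliers [u], [v] of the fuzzy rule at scale [1 / (k + 1)] may be
    unbounded, so they are scaled by [s = (1 + |u|)^-1] before passing to the
    limit.  If the limit [sg] of the factors [s] is positive, dividing by it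
    yields the multipliers sought.  If [sg = 0], the limits of [s u] and [s v]
    are opposite, the former being a horizon subgradient, and [|s u| + s = 1]
    makes it nonzero, against the qualification condition. *)
Lemma QC_sum_rule n (f : 'rV[R]_n -> \bar R) (S : set 'rV[R]_n)
    (x w : 'rV[R]_n) (C : R) :
  (forall y, f y <> -oo%E) -> lower_semicontinuous f -> closed S -> QC f S ->
  (edom f `&` S) x ->
  (\forall y \near x, S y ->
     (f x <= f y + (dot w (y - x) + C * dot (y - x) (y - x))%:E)%E) ->
  exists u v, [/\ subdiff f x u, limiting_normal S x v & u + v + w = 0].
Proof.
move=> fNy lscf clS qc fSx minx.
have fuzzy := fuzzy_sum_rule fNy lscf clS fSx minx.
have /choice[Q QP] : forall k : nat,
    exists q : ('rV[R]_n * 'rV[R]_n) * ('rV[R]_n * 'rV[R]_n),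
    [/\ edom f q.1.1, S q.1.2, `|q.1.1 - x| < k.+1%:R^-1, `|q.1.2 - x| < k.+1%:R^-1
      & `|fine (f q.1.1) - fine (f x)| < k.+1%:R^-1] /\
    [/\ regular_normal (epigraph f) (adjoin q.1.1 (fine (f q.1.1))) (adjoin q.2.1 (-1)),
        regular_normal S q.1.2 q.2.2 & `|q.2.1 + q.2.2 + w| < k.+1%:R^-1].
  move=> k; have [|y [z [u [v yzuv]]]] := fuzzy k.+1%:R^-1; first by rewrite invr_gt0.
  by exists ((y, z), (u, v)).
pose s k := (1 + `|(Q k).2.1|)^-1.
have s0 k : 0 < s k by rewrite invr_gt0 ltr_pwDl.
have s1 k : s k <= 1 by rewrite invf_le1 ?lerDl// ltr_pwDl.
pose q k := (s k *: (Q k).2.1, s k).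
have qn k : `|(q k).1| + (q k).2 = 1.
  rewrite /= normrZ gtr0_norm// -[X in _ + X]mulr1 -mulrDr [_ + 1]addrC.
  by rewrite mulVf// gt_eqF// ltr_pwDl.
pose K : set ('rV[R]_n * R) := [set u | `|u - 0| <= 1] `*` `[0, 1]%classic.
have cK : compact K.
  by apply: compact_setX; [exact: cball_compact|exact: segment_compact].
have qK k : K (q k).
  split; last by rewrite /= in_itv /= s1 ltW.
  by have := qn k; rewrite /= subr0 => <-; rewrite lerDl ltW.
have [[u sg] [_ /=]] := compact_seq_cluster cK qK.
rewrite in_itv /= => /andP[sg0 _] clc.
have approx (e : R) : 0 < e -> exists k : nat,
    [/\ k.+1%:R^-1 < e, `|(q k).1 - u| < e & `|(q k).2 - sg| < e].
  move=> e0.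
  have [N _ NP] := near_infty_natSinv_lt (PosNum e0).
  have [|k Nk [ku ks]] := clc ([set v | `|v - u| < e] `*` [set t | `|t - sg| < e]) N.
    exists ([set v | `|v - u| < e], [set t | `|t - sg| < e]) => //=; split.
      exact: norm_lt_near.
    apply/nbhs_ballP; exists e => //= t.
    by rewrite -ball_normE /ball_ /= distrC.
  by exists k; split => //; exact: (NP _ Nk).
have Nepi : limiting_normal (epigraph f) (adjoin x (fine (f x))) (adjoin u (- sg)).
  apply: limiting_normal_approx => e e0.
  have [k [ke qu qs]] := approx e e0.
  have [[fy _ yx _ fyx] [Ny _ _]] := QP k.
  exists (adjoin (Q k).1.1 (fine (f (Q k).1.1))), (s k *: adjoin (Q k).2.1 (-1)).
  split.
  - exists (Q k).1.1, (fine (f (Q k).1.1)); split=> //.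
    by rewrite fineK_lty.
  - exact: regular_normalZ.
  - rewrite adjoinB; apply/adjoin_norm_lt => //; split; exact: lt_trans ke.
  - rewrite adjoinZ adjoinB mulrN1 -opprD; apply/adjoin_norm_lt => //; split=> //.
    by rewrite normrN.
(* s v = s (u + v + w) - s u - s w, and u + v + w tends to 0 *)
have NS : limiting_normal S x (- (sg *: w) - u).
  apply: limiting_normal_approx => e e0.
  have den0 : 0 < 2 + `|w| by rewrite ltr_pwDl.
  have [k [ke qu qs]] := approx (e / (2 + `|w|)) (divr_gt0 e0 den0).
  have [[_ Sz _ zx _] [_ Nz uvw]] := QP k.
  exists (Q k).1.2, (s k *: (Q k).2.2); split=> //.
  - exact: regular_normalZ.
  - apply: lt_trans zx (lt_le_trans ke _).
    by rewrite ler_pdivrMr// ler_peMr ?ltW//; have := normr_ge0 w; lra.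
  - rewrite [X in `|X|](_ : _ = s k *: ((Q k).2.1 + (Q k).2.2 + w)
        - ((s k *: (Q k).2.1 - u) + (s k - sg) *: w)); last first.
      by apply/rowP => i; rewrite !mxE; ring.
    rewrite (le_lt_trans (ler_normB _ _))//.
    rewrite (le_lt_trans (lerD (lexx _) (ler_normD _ _)))// !normrZ (gtr0_norm (s0 k)).
    have e1 : s k * `|(Q k).2.1 + (Q k).2.2 + w| < e / (2 + `|w|).
      by rewrite (le_lt_trans _ (lt_trans uvw ke))// ler_piMl.
    have e2 : `|s k - sg| * `|w| <= e / (2 + `|w|) * `|w|.
      by rewrite ler_wpM2r// ltW.
    have e3 : e = e / (2 + `|w|) * 2 + e / (2 + `|w|) * `|w|.
      by rewrite -mulrDr divfK// gt_eqF.
    rewrite /= in qu; rewrite [X in _ < X]e3; lra.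
move: sg0; rewrite le_eqVlt => /orP[/eqP sg0|sg0]; last first.
  exists (sg^-1 *: u), (sg^-1 *: (- (sg *: w) - u)); split.
  - have := limiting_normalZ _ Nepi; rewrite -invr_gt0 in sg0 => /(_ _ sg0).
    by rewrite adjoinZ mulrN mulVf// -invr_eq0 gt_eqF.
  - by apply: limiting_normalZ => //; rewrite invr_gt0.
  - rewrite scalerBr scalerN scalerA mulVf ?gt_eqF// scale1r.
    by apply/rowP => i; rewrite !mxE; ring.
subst sg.
have : (horizon_subdiff f x `&` [set - v | v in limiting_normal S x]) u.
  split; first by rewrite /horizon_subdiff /= -oppr0.
  by exists (- u); rewrite ?opprK//; move: NS; rewrite scale0r oppr0 sub0r.
rewrite qc// => u0; have [|k [_ + +]] := approx (1 / 2); first by lra.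
by rewrite u0 !subr0 => a1 /ltr_normlW a2; have := qn k; lra.
Qed.

End ExactRule.

Section Compactness.
Context {R : realType}.

Lemma dot_CS n (u v : 'rV[R]_n) : dot u v ^+ 2 <= dot u u * dot v v.
Proof.
have [v0|v0] := ltP 0 (dot v v); last first.
  by rewrite (dot_eq0 v0) !dot0 mulr0 expr0n.
have := dot_ge0 (dot v v *: u - dot u v *: v).
rewrite !dotE (dotC v u) => h.
have : 0 <= dot v v * (dot u u * dot v v - dot u v ^+ 2) by lra.
by rewrite pmulr_rge0// subr_ge0.
Qed.

Lemma norm_le_enorm n (u : 'rV[R]_n) : `|u| <= enorm u.
Proof.
rewrite [X in X <= _]/Num.norm/= mx_normrE; apply/bigmax_leP; split=> [|[j i] _ /=].
  exact: enorm_ge0.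
rewrite ord1 -ler_sqr ?nnegrE ?enorm_ge0// enorm_sqr real_normK ?num_real//.
rewrite /dot (bigD1 i)//= expr2 lerDl sumr_ge0// => k _.
by rewrite -expr2 sqr_ge0.
Qed.

Lemma eball_compact n r : compact (@eball R n r).
Proof.
have [r0|r0] := leP 0 r; last first.
  rewrite (_ : eball r = set0); first exact: compact0.
  by apply/seteqP; split=> // x /= xr; have := enorm_ge0 x; rewrite leNgt (le_lt_trans xr).
apply: (subclosed_compact _ (@cball_compact R n 0 r)).
  rewrite (_ : eball r = (fun x : 'rV[R]_n => dot x x) @^-1` [set t | t <= r ^+ 2]).
    have c : continuous (fun x : 'rV[R]_n => dot x x) by apply: dot_continuous => y; exact: cvg_id.
    by apply: closed_comp => [y _|]; [exact: c|exact: closed_le].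
  by apply/seteqP; split=> x; rewrite /eball /= enorm_le.
by move=> x /= xr; rewrite subr0 (le_trans (norm_le_enorm x)).
Qed.

End Compactness.

(** * Points of the tangency variety minimizing over large balls *)

Section TangencyMinimizers.
Context {R : realType}.

(** Minimizing [f] on a sphere would ask for a qualification condition on the
    constraint [|x| = t].  The radial penalty [M (max 0 (|x|^2 - r^2))^2]
    avoids it: it is continuously differentiable with gradient proportional to
    [x], so the sum rule puts its minimizers in the tangency variety, and it
    vanishes on the ball of radius [r], so there they compare [f] alone. *)
Lemma tangency_minimizer n (f : 'rV[R]_n -> \bar R) (S : set 'rV[R]_n) (r : R) :
  (forall y, f y <> -oo%E) -> lower_semicontinuous f -> closed S -> QC f S ->
  0 <= r -> edom f `&` S `&` eball r !=set0 ->
  exists2 x, tangency_variety f S x &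
    forall y, S y -> enorm y <= r -> (f x <= f y)%E.
Proof.
move=> fNy lscf clS qc r0 [y0 [[fy0 Sy0] y0r]].
have ffin y : (f y < +oo)%E -> (fine (f y))%:E = f y by exact: fineK_lty.
have r10 : 0 <= r + 1 by lra.
pose A := eball (r + 1) `&` S.
have cA : compact A by apply: compact_closedI => //; exact: eball_compact.
have Ay0 : A y0 by split => //; rewrite /eball /= (le_trans y0r)// lerDl.
have A0 : A !=set0 by exists y0.
have [x1 Ax1 minx1] := lsc_attains_min fNy lscf cA A0.
pose L := fine (f x1); pose b := fine (f y0).
have fx1 : f x1 = L%:E by rewrite ffin// (le_lt_trans (minx1 _ Ay0)).
have Lb : L <= b by rewrite -lee_fin -fx1 ffin// minx1.
(* on the sphere of radius r + 1 the penalty is M (2r + 1)^2 >= M > b - L, so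
   that a minimizer, of value at most b, stays inside *)
pose M := b - L + 1; have M0 : 0 < M by rewrite /M; lra.
pose s (x : 'rV[R]_n) := Num.max 0 (dot x x - r ^+ 2).
have cdot : continuous (fun x : 'rV[R]_n => dot x x).
  by apply: dot_continuous => y; exact: cvg_id.
have cs : continuous s.
  move=> x.
  have c1 : {for x, continuous (fun x => dot x x - r ^+ 2)}.
    by apply: (@cvgB _ _ _ (nbhs x) _ (fun x => dot x x) (cst (r ^+ 2)));
      [exact: cdot|exact: cvg_cst].
  by have := @continuous_max R _ (cst 0) _ x (@cst_continuous _ _ 0 x) c1.
have lscp : lower_semicontinuous (fun x => f x + (M * s x ^+ 2)%:E)%E.
  have cs2 : continuous (fun x => s x ^+ 2) by move=> x; exact: (cvgM (cs x) (cs x)).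
  by apply: lsc_addr => // x; exact: (cvgMl_tmp (cs2 x)).
have pNy x : (f x + (M * s x ^+ 2)%:E)%E <> -oo%E by case: (f x) (fNy x).
have [x [xr Sx] minx] := lsc_attains_min pNy lscp cA A0.
have s_in y : enorm y <= r -> s y = 0.
  by rewrite enorm_le// => yr; apply/max_idPl; rewrite subr_le0.
have pen0 y : 0 <= M * s y ^+ 2 by rewrite mulr_ge0 ?sqr_ge0// ltW.
have fx : (f x < +oo)%E.
  rewrite ltey; apply/eqP => fx; have := minx _ Ay0.
  by rewrite fx addye// (s_in _ y0r) expr0n mulr0 adde0 leNgt fy0.
have xlt : dot x x < (r + 1) ^+ 2.
  have := minx _ Ay0; have := minx1 x (conj xr Sx).
  rewrite (s_in _ y0r) expr0n mulr0 adde0 -(ffin x fx) fx1 -(ffin y0 fy0).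
  rewrite -EFinD !lee_fin -/b => Lx xb.
  rewrite ltNge; apply/negP => xge.
  have s1 : 1 <= s x by rewrite le_max; apply/orP; right; nra.
  have : M <= M * s x ^+ 2 by rewrite ler_peMr ?(ltW M0)// exprn_ege1.
  by rewrite /M in Lx xb *; lra.
exists x; last first.
  move=> y Sy yr; have Ay : A y by split => //; rewrite /eball /= (le_trans yr)// lerDl.
  have := minx _ Ay; rewrite (s_in _ yr) expr0n mulr0 adde0; apply: le_trans.
  by rewrite leeDl// lee_fin.
have near_x : \forall y \near x, dot y y < (r + 1) ^+ 2.
  have /cvgrPdist_lt /(_ ((r + 1) ^+ 2 - dot x x)) := cdot x.
  rewrite subr_gt0 => /(_ xlt); apply: filterS => y.
  by rewrite ltr_norml => /andP[? ?]; lra.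
(* the quadratic error constant comes from |y|^2 - |x|^2 = <x + y, y - x> *)
have [] := @QC_sum_rule R n f S x ((4 * M * s x) *: x)
  (2 * M * s x + 4 * M * (r + 1) ^+ 2) fNy lscf clS qc.
- by split.
- apply: filterS near_x => y ylt Sy.
  have Ay : A y by split => //; rewrite /eball /= enorm_le// ltW.
  have := minx _ Ay; rewrite -(ffin x fx).
  case: (f y) (fNy y) => [a _| _ _|//]; last by rewrite addye// leey.
  rewrite -!EFinD !lee_fin => le.
  have [j yE] : exists j, y = x + j by exists (y - x); rewrite addrC subrK.
  have -> : y - x = j by rewrite yE addrC addKr.
  pose t := dot y y - dot x x.
  have tE : t = 2 * dot x j + dot j j.
    by rewrite /t yE !dotE (dotC j x); ring.
  have tsq : t ^+ 2 <= 4 * (r + 1) ^+ 2 * dot j j.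
    have -> : t = dot (x + y) j.
      by rewrite /t yE !dotE (dotC j x); ring.
    apply: (le_trans (dot_CS _ _)); rewrite ler_wpM2r ?dot_ge0//.
    have := dot_ge0 (x - y); rewrite !dotE (dotC y x).
    by lra.
  have sq_pos : s y ^+ 2 <= s x ^+ 2 + 2 * s x * t + t ^+ 2.
    have sxE : s x = Num.max 0 (dot x x - r ^+ 2) by [].
    have -> : s y = Num.max 0 (dot x x - r ^+ 2 + t).
      by rewrite /s /t; congr Num.max; ring.
    rewrite sxE; move: (dot x x - r ^+ 2) => i.
    by have [?|?] := leP 0 i; have [?|?] := leP 0 (i + t); nra.
  have : M * s y ^+ 2 <= M * (s x ^+ 2 + 2 * s x * t + t ^+ 2).
    by rewrite ler_wpM2l// ltW.
  have : M * t ^+ 2 <= M * (4 * (r + 1) ^+ 2 * dot j j).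
    by rewrite ler_wpM2l// ltW.
  rewrite dotZl; move: tE => -> ; lra.
move=> u [v [fu Sv uv0]]; split; first by [].
by exists (4 * M * s x), u => //; exists v.
Qed.

End TangencyMinimizers.

(** * The pieces at infinity *)

Section Pieces.
Context (R : realType).
Context (n : nat) (f : 'rV[R]_n -> \bar R) (S : set 'rV[R]_n) (rho : R)
  (l : nat) (C : 'I_l -> set 'rV[R]_n)
  (m : nat) (F : 'I_l -> set 'rV[R]_m) (h : 'rV[R]_m * R -> 'rV[R]_n)
  (p : nat) (G : 'I_p -> set 'rV[R]_n)
  (dec : decomposition_at_infinity f S rho C F h G).

Lemma pieces_cover x : tangency_variety f S x -> rho < enorm x ->
  exists k, G k x.
Proof.
move=> Gx rx.
have [[_ _ surj] _] := dec_h_homeo dec.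
have [|[a t] [[i _ Fa] /= rt] <-] := surj x.
  by split=> // /=; rewrite /eball /=; apply/negP; rewrite -ltNge.
have [_ _ surjG] := dec_G dec.
have [|k _ Gk] := surjG (h @` (connected_component (F i) a `*` ray rho)).
  by exists (connected_component (F i) a) => //; exists i => //; exists a.
exists k; rewrite Gk; exists (a, t) => //; split=> //=.
exact: connected_component_refl.
Qed.

Lemma piece_meets_spheres k t : rho < t ->
  exists x, [/\ G k x, enorm x = t & tangency_variety f S x].
Proof.
move=> rt; have [fG _ _] := dec_G dec.
have [F' [i _ [a Fa <-]] Gk] := fG k I.
have Fia : (\bigcup_i F i) a by exists i.
exists (h (a, t)); split; last 2 first.
- exact: (dec_h_norm dec).
- have [[fh _ _] _] := dec_h_homeo dec.
  by have [] := fh (a, t) (conj Fia rt).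
rewrite -Gk; exists (a, t) => //; split=> //=.
exact: connected_component_refl.
Qed.

End Pieces.

Lemma attains_inf_iff (R : realType) (T : Type) (f : T -> \bar R) (S : set T) :
  (exists2 x, S x & f x = ereal_inf [set f y | y in S]) <->
  (exists2 x, S x & forall y, S y -> (f x <= f y)%E).
Proof.
split=> -[x Sx xmin]; exists x => //.
  by move=> y Sy; rewrite xmin; apply: ereal_inf_lbound; exists y.
apply/eqP; rewrite eq_le; apply/andP; split.
  by apply: le_ereal_inf_tmp => _ [y Sy <-]; exact: xmin.
by apply: ereal_inf_lbound; exists x.
Qed.

Lemma finite_minimum (R : realType) (I : finType) (K : set I) (lam : I -> \bar R) :
  exists a, is_minimum [set lam k | k in K] a.
Proof.
have [[k0 Kk0]|/nonemptyPn K0] := pselect (K !=set0); last first.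
  by exists +oo%E; right; split=> //; rewrite K0 image_set0.
have Kk0' : k0 \in K by rewrite inE.
have [k Kk kmin] := @arg_minP _ _ _ k0 (mem K) lam Kk0'.
exists (lam k); left; split; first by exists k => //; rewrite -inE.
by move=> _ [j Kj <-]; apply: kmin; rewrite inE.
Qed.

(** Eventually each index is captured by one of finitely many [G k]; one of
    them captures infinitely many. *)
Lemma finite_pigeonhole (p : nat) (G : 'I_p -> nat -> Prop) :
  (exists N, forall j, (N <= j)%N -> exists k, G k j) ->
  exists k, forall N, exists2 j, (N <= j)%N & G k j.
Proof.
move=> [N NG]; apply: contrapT => /forallNP noG.
have /choice[b bP] : forall k, exists b, forall j, (b <= j)%N -> ~ G k j.
  by move=> k; have /existsNP[b bP] := noG k; exists b => j bj Gj; apply: bP; exists j.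
have [k] := NG (maxn N (\max_k b k)) (leq_maxl _ _).
by apply: bP; rewrite leq_max leq_bigmax orbT.
Qed.

(** * The existence theorem *)

(** If the minimizers [x j] over the growing balls come back infinitely often to
    a fixed ball, the minimum of [f] over that ball is a global one. *)
Lemma attained_of_bounded_minimizers (R : realType) n (f : 'rV[R]_n -> \bar R)
    (S : set 'rV[R]_n) (c B : R) (x : nat -> 'rV[R]_n) :
  (forall y, f y <> -oo%E) -> lower_semicontinuous f -> closed S ->
  (forall j, S (x j)) ->
  (forall j y, S y -> enorm y <= c + j%:R -> (f (x j) <= f y)%E) ->
  (forall N, exists2 j, (N <= j)%N & enorm (x j) <= B) ->
  exists2 z, S z & forall y, S y -> (f z <= f y)%E.
Proof.
move=> fNy lscf clS Sx minx xB.
have cA : compact (eball B `&` S).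
  by apply: compact_closedI => //; exact: eball_compact.
have [j0 _ j0B] := xB 0%N.
have [|z [_ Sz] minz] := lsc_attains_min fNy lscf cA; first by exists (x j0).
exists z => // y Sy.
have [j Nj jB] := xB (Num.bound `|enorm y - c|).
apply: (le_trans (minz (x j) (conj jB (Sx j)))); apply: minx => //.
rewrite -lerBlDl (le_trans (ler_norm _))//.
by rewrite (le_trans (ltW (archi_boundP (normr_ge0 _))))// ler_nat.
Qed.

Unset Implicit Arguments.

Theorem theorem4p4 (R : realType) (n : nat)
    (f : 'rV[R]_n -> \bar R) (S : set 'rV[R]_n)
    (f_proper : forall x, f x <> -oo%E)
    (f_lsc : lower_semicontinuous f)
    (f_semialg : semialgebraic_efun f)
    (S_closed : closed S)
    (S_semialg : semialgebraic S)
    (dom_nonempty : edom f `&` S !=set0)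
    (dom_unbounded : forall r : R, exists2 x, (edom f `&` S) x & r < enorm x)
    (qc : QC f S)
    (rho : R)
    (l : nat) (C : 'I_l -> set 'rV[R]_n)
    (m : nat) (F : 'I_l -> set 'rV[R]_m) (h : 'rV[R]_m * R -> 'rV[R]_n)
    (p : nat) (G : 'I_p -> set 'rV[R]_n)
    (dec : decomposition_at_infinity f S rho C F h G)
    (fk : 'I_p -> R -> R)
    (fkP : slice_values f rho G fk)
    (lam : 'I_p -> \bar R)
    (lamP : forall k, (fk k t)%:E @[t --> +oo%R] --> lam k) :
  (exists2 x, S x & f x = ereal_inf [set f y | y in S]) <->
  (critical_points f S !=set0 /\
   exists m1 m2 : \bar R,
     [/\ is_minimum [set f x | x in critical_points f S] m1,
         is_minimum [set lam k | k in nonconstant_indices rho fk] m2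
       & (m1 <= m2)%E]).
Proof.
rewrite attains_inf_iff; split=> [[x Sx xmin]|].
  have [y0 [fy0 Sy0]] := dom_nonempty.
  have fx : edom f x by exact: le_lt_trans (xmin _ Sy0) fy0.
  have crit : critical_points f S x.
    have [||u [v [fu Sv uv0]]] := @QC_sum_rule R n f S x 0 0 f_proper f_lsc S_closed qc.
    - by split.
    - apply: filterE => y Sy; rewrite mul0r dotC dot0 addr0.
      by rewrite adde0 xmin.
    by split=> //; exists u => //; exists v => //; rewrite -uv0 addr0.
  split; first by exists x.
  have [m2 m2P] := finite_minimum (nonconstant_indices rho fk) lam.
  exists (f x), m2; split=> //.
    left; split; first by exists x.
    by move=> _ [y [[_ Sy] _] <-]; exact: xmin.
  case: m2P => [[[k _ <-] _]|[_ ->]]; last exact: leey.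
  apply: (cvge_ge _ (lamP k)); exists rho; split; first exact: num_real.
  move=> t rt; have [y [Gy yt [[_ Sy] _]]] := piece_meets_spheres dec k rt.
  by rewrite -(fkP _ _ _ rt (conj Gy yt)); exact: xmin.
move=> [_ [m1 [m2 [m1P m2P m12]]]].
have [y0 [fy0 Sy0]] := dom_nonempty.
have /choice[x xP] : forall j : nat, exists x, tangency_variety f S x /\
    forall y, S y -> enorm y <= enorm y0 + j%:R -> (f x <= f y)%E.
  move=> j; have [||x] := tangency_minimizer (r := enorm y0 + j%:R) f_proper f_lsc S_closed qc.
  - by rewrite addr_ge0 ?enorm_ge0.
  - by exists y0; split=> //; rewrite /eball /= lerDl.
  - by exists x.
have Sx j : S (x j) by have [[[]]] := xP j.
have minx j y : S y -> enorm y <= enorm y0 + j%:R -> (f (x j) <= f y)%E.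
  by have [_] := xP j; apply.
have [[B xB]|unb] := pselect (exists B, forall N, exists2 j, (N <= j)%N & enorm (x j) <= B).
  exact: attained_of_bounded_minimizers minx xB.
(* henceforth the minimizers x j escape to infinity *)
have {}unb B : exists N, forall j, (N <= j)%N -> B < enorm (x j).
  apply: contrapT => noN; apply: unb; exists B => N; apply: contrapT => noj.
  apply: noN; exists N => j Nj; rewrite ltNge; apply/negP => xjB.
  by apply: noj; exists j.
have [k Gk] : exists k, forall N, exists2 j, (N <= j)%N & G k (x j).
  apply: finite_pigeonhole; have [N NP] := unb rho.
  by exists N => j Nj; apply: (pieces_cover dec); [exact: (xP j).1|exact: NP].
(* the balls over which the x j of G k minimize exhaust the space *)
have far y B : S y -> exists j, [/\ G k (x j), B < enorm (x j) & (f (x j) <= f y)%E].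
  move=> Sy; have [N NB] := unb B.
  have [j] := Gk (maxn N (Num.bound `|enorm y - enorm y0|)).
  rewrite geq_max => /andP[Nj yj] Gj; exists j; split=> //; first exact: NB.
  apply: minx => //; rewrite -lerBlDl (le_trans (ler_norm _))//.
  by rewrite (le_trans (ltW (archi_boundP (normr_ge0 _))))// ler_nat.
have [[c cP]|Kk] := pselect (exists c, forall t, rho < t -> fk k t = c).
  have fxc j : G k (x j) -> rho < enorm (x j) -> f (x j) = c%:E.
    by move=> Gj rj; rewrite (fkP _ _ _ rj (conj Gj erefl)) cP.
  have [j [Gj rj _]] := far y0 rho Sy0.
  exists (x j) => // y Sy; have [i [Gi ri]] := far y rho Sy.
  by rewrite (fxc i)// (fxc j).
have lam_le y : S y -> (lam k <= f y)%E.
  move=> Sy; rewrite leNgt; apply/negP => ylam.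
  have [B [_ BP]] : \forall t \near +oo, (f y < (fk k t)%:E)%E.
    have : nbhs (lam k) [set a | (f y < a)%E].
      by apply: open_nbhs_nbhs; split=> //; exact: open_ereal_gt_ereal.
    by move/(lamP k).
  have [j [Gj]] := far y (Num.max rho B) Sy.
  rewrite gt_max => /andP[rj Bj]; rewrite (fkP _ _ _ rj (conj Gj erefl)).
  by rewrite leNgt BP.
have m2_le : (m2 <= lam k)%E.
  case: m2P => [[_]|[K0 _]]; first by apply; exists k.
  by have : set0 (lam k) by rewrite -K0; exists k.
case: m1P => [[[z [[_ Sz] _] zm1] _]|[_ m1y]].
  by exists z => // y /lam_le; apply: le_trans; rewrite zm1 (le_trans m12).
have := lam_le _ Sy0; rewrite leNgt (lt_le_trans fy0)// (le_trans _ m2_le)//.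
by rewrite -m1y.
Qed.
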